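(* Let $B>0$. For the transmission-time minimization problem $\mathcal T$ for the single-user Gaussian channel with an energy harvesting source that has $B$ bits to send, the lazy online algorithm is $2$-competitive if $B\le\lim_{T\to\infty}T\log\left(1+\frac{E_0}{T}\right)$; that is, its completion time is at most $2\,\mathcal T_O(\boldsymbol\sigma)$ for every energy arrival sequence $\boldsymbol\sigma$ with $\mathcal T_O(\boldsymbol\sigma)<\infty$ whose initial energy $E_0$ satisfies this inequality.
   Context: All logarithms are base 2. Energy arrivals. An energy arrival sequence $\boldsymbol\sigma$ is a finite or infinite sequence of pairs $(t_i,E_i)$, $i=0,1,2,\dots$, with $0=t_0<t_1<t_2<\cdots$ (with $t_i\to\infty$ if the sequence is infinite) and $E_i>0$: the source receives energy $E_i$ at time $t_i$. The sequence is arbitrary (no distribution is assumed). Transmission. All $B$ bits are available at time $0$. The source uses a piecewise constant nonnegative transmit power $P(t)$, $t\ge 0$, with finitely many changes on any bounded time interval. Transmitting with constant power $P$ for a duration $T$ uses energy $PT$ and sends $T\log(1+P)$ bits. Thus by time $t$ the number of bits sent is $B(t)=\int_0^t\log(1+P(s))\,ds$ and the energy used is $E(t)=\int_0^t P(s)\,ds$. The power profile is feasible for $\boldsymbol\sigma$ if it satisfies energy neutrality: $E(t)\le\sum_{i:\,t_i\le t}E_i$ for all $t\ge0$. The completion time of a profile is the smallest $T$ with $B(T)=B$ ($+\infty$ if there is none). Problem $\mathcal T$. Minimize the completion time over feasible power profiles. $\mathcal T_O(\boldsymbol\sigma)$ denotes the minimum completion time over all power profiles feasible for $\boldsymbol\sigma$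 (the optimal offline algorithm, which knows all of $\boldsymbol\sigma$ in advance; $+\infty$ if no feasible profile completes). Lazy online algorithm. At each energy arrival instant $t_i$, $i=0,1,\dots$, as long as transmission is not complete, let $\hat E_i$ be the available energy (left over energy plus the new arrival $E_i$) and $\hat B_i$ the number of bits still to be transmitted. Find the minimum $T_i$ such that $T_i\log\left(1+\frac{\hat E_i}{T_i}\right)=\hat B_i$, and transmit with constant power $P_i=\hat E_i/T_i$ until the next energy arrival $t_{i+1}$ (or until all bits are sent, if this happens earlier or there is no further arrival). Convention: if no finite such $T_i$ exists, transmit with zero power until the next arrival. *)

(* Defs.v *)
From Stdlib Require Export Reals.
From Stdlib Require Import ClassicalEpsilon.
From Coquelicot Require Export Coquelicot.
Open Scope R_scope.

Definition log2 (x : R) : R := ln x / ln 2.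

Definition is_least (S : R -> Prop) (m : R) : Prop :=
  S m /\ forall x, S x -> m <= x.

(* The smallest element of S, or +oo if S has none. *)
Definition least (S : R -> Prop) : Rbar :=
  match excluded_middle_informative (exists m, is_least S m) with
  | left h => Finite (proj1_sig (constructive_indefinite_description _ h))
  | right _ => p_infty
  end.

(* [Some n]: the arrivals are numbered 0, ..., n;  [None]: infinitely many. *)
Definition in_range (last : option nat) (i : nat) : bool :=
  match last with
  | Some n => Nat.leb i n
  | None => true
  end.

(* Values of [arr_time] and [arr_energy] outside the range are meaningless. *)
Record arrivals := Arrivals {
  arr_last : option nat;
  arr_time : nat -> R;
  arr_energy : nat -> R;
  arr_time_0 : arr_time 0 = 0;
  arr_time_lt : forall i,
    in_range arr_last (S i) = true -> arr_time i < arr_time (S i);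
  arr_time_lim : arr_last = None -> is_lim_seq arr_time p_infty;
  arr_energy_pos : forall i, in_range arr_last i = true -> 0 < arr_energy i }.

Definition arrives (sigma : arrivals) (i : nat) : bool :=
  in_range (arr_last sigma) i.

(* Only finitely many terms of the series are nonzero. *)
Definition harvested (sigma : arrivals) (t : R) : R :=
  Series (fun i =>
    if arrives sigma i then
      if Rle_dec (arr_time sigma i) t then arr_energy sigma i else 0
    else 0).

(* The values taken at the finitely many breakpoints of a step function are
   unconstrained (apart from being nonnegative); they do not affect any
   integral. *)
Definition power_profile (P : R -> R) : Prop :=
  (forall t, 0 <= t -> 0 <= P t) /\
  (forall t, 0 <= t -> inhabited (IsStepFun P 0 t)).

Definition bits_sent (P : R -> R) (t : R) : R :=
  RInt (fun s => log2 (1 + P s)) 0 t.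

Definition energy_used (P : R -> R) (t : R) : R := RInt P 0 t.

Definition feasible (sigma : arrivals) (P : R -> R) : Prop :=
  power_profile P /\
  forall t, 0 <= t -> energy_used P t <= harvested sigma t.

Definition completion_time (B : R) (P : R -> R) : Rbar :=
  least (fun T => 0 <= T /\ bits_sent P T = B).

(* An infimum, so that nothing is assumed about its being attained; it is the
   minimum whenever the minimum exists, and +oo if no feasible profile
   completes. *)
Definition offline_time (sigma : arrivals) (B : R) : Rbar :=
  Glb_Rbar (fun T =>
    exists P, feasible sigma P /\ completion_time B P = Finite T).

(* In the functions below, E is the available energy and b the number of bits
   still to be sent at an arrival instant. *)

(* +oo when transmission is complete or no finite solution exists. *)
Definition lazy_duration (E b : R) : Rbar :=
  if Rlt_dec 0 b then least (fun T => 0 < T /\ T * log2 (1 + E / T) = b)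
  else p_infty.

Definition lazy_rate (E b : R) : R :=
  match lazy_duration E b with
  | Finite T => E / T
  | _ => 0
  end.

(* The pair (available energy, remaining bits) at the i-th arrival.  The lazy
   power is used until the next arrival or until all bits are sent, whichever
   comes first, hence the [Rbar_min]. *)
Fixpoint lazy_state (sigma : arrivals) (B : R) (i : nat) : R * R :=
  match i with
  | O => (arr_energy sigma 0, B)
  | S j =>
      let (E, b) := lazy_state sigma B j in
      let p := lazy_rate E b in
      let d := real (Rbar_min (Finite (arr_time sigma (S j) - arr_time sigma j))
                              (lazy_duration E b)) in
      (E - p * d + arr_energy sigma (S j), b - d * log2 (1 + p))
  end.

Definition latest_arrival (sigma : arrivals) (s : R) (i : nat) : Prop :=
  arrives sigma i = true /\ arr_time sigma i <= s /\
  (arrives sigma (S i) = true -> s < arr_time sigma (S i)).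

(* For s >= 0 exactly one index satisfies [latest_arrival sigma s]. *)
Definition current (sigma : arrivals) (s : R) : nat :=
  epsilon (inhabits 0%nat) (latest_arrival sigma s).

Definition lazy_profile (sigma : arrivals) (B : R) (s : R) : R :=
  let i := current sigma s in
  let (E, b) := lazy_state sigma B i in
  if Rbar_lt_dec (Finite (s - arr_time sigma i)) (lazy_duration E b)
  then lazy_rate E b else 0.

Definition lazy_time (sigma : arrivals) (B : R) : Rbar :=
  completion_time B (lazy_profile sigma B).

(* Main.v *)
(** Along the lazy algorithm the power never decreases and the projected
completion time never increases, because an arrival only adds energy to the
current plan.  Let [T] be the completion time of a feasible profile, [H] the
energy harvested by time [T], and consider the last arrival before [T], where
the lazy algorithm plans to send its remaining [b] bits in time [T'] with its
remaining energy [E].  The bits per unit of energy, [log2 (1 + p) / p], decrease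
with the power [p], so all the energy [H] is spent at least as efficiently as at
the last power [E / T'].  By Jensen's inequality the profile sends at most
[T * log2 (1 + H / T)] bits, so it is at most as efficient as the power [H / T].
Hence [H / T <= E / T'], so [T' <= T * E / H <= T], and the lazy algorithm
finishes by time [2 * T]. *)

Require Import Defs.
From Stdlib Require Import Reals Ranalysis5 Lra Lia Classical ClassicalEpsilon.
From Coquelicot Require Import Coquelicot.
Open Scope R_scope.

(** * Logarithm inequalities and the solvability of the duration equation *)

Lemma ln_le_pred (x : R) : 0 < x -> ln x <= x - 1.
Proof.
intros hx. generalize (exp_ineq1_le (ln x)). rewrite exp_ln by exact hx. lra.
Qed.

Lemma ln_lt_pred (x : R) : 0 < x -> x <> 1 -> ln x < x - 1.
Proof.
intros hx h1.
assert (hl : ln x <> 0) by (apply ln_neq_0; lra).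
generalize (exp_ineq1 _ hl). rewrite exp_ln by exact hx. lra.
Qed.

Lemma ln2_pos : 0 < ln 2.
Proof. rewrite <- ln_1. apply ln_increasing; lra. Qed.

Lemma log2_0 : log2 (1 + 0) = 0.
Proof. unfold log2. rewrite Rplus_0_r, ln_1. unfold Rdiv. ring. Qed.

Lemma log2_1p_pos (x : R) : 0 < x -> 0 < log2 (1 + x).
Proof.
intros hx. apply Rdiv_lt_0_compat; [| exact ln2_pos].
rewrite <- ln_1. apply ln_increasing; lra.
Qed.

Lemma log2_1p_lt (x : R) : 0 < x -> log2 (1 + x) < x / ln 2.
Proof.
intros hx. apply Rmult_lt_compat_r.
- apply Rinv_0_lt_compat, ln2_pos.
- generalize (ln_lt_pred (1 + x) ltac:(lra) ltac:(lra)). lra.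
Qed.

(** Concavity of the logarithm: this is [ln z <= z - 1] at [z = (1 + x) / (1 + q)]. *)
Lemma log2_1p_tangent (q x : R) : 0 <= q -> 0 <= x ->
  log2 (1 + x) <= log2 (1 + q) + (x - q) * / ((1 + q) * ln 2).
Proof.
intros hq hx.
assert (hl := ln2_pos).
assert (h : ln ((1 + x) / (1 + q)) <= (1 + x) / (1 + q) - 1)
  by (apply ln_le_pred, Rdiv_lt_0_compat; lra).
rewrite ln_div in h by lra.
replace ((x - q) * / ((1 + q) * ln 2)) with (((1 + x) / (1 + q) - 1) / ln 2)
  by (field; lra).
unfold log2, Rdiv. rewrite <- Rmult_plus_distr_r.
apply Rmult_le_compat_r; [apply Rlt_le, Rinv_0_lt_compat; lra |].
unfold Rdiv in h; lra.
Qed.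

(* Bits per unit of energy, [log2 (1 + x) / x], strictly decrease with the power. *)
Lemma efficiency_decr (x y : R) : 0 < x < y ->
  x * log2 (1 + y) < y * log2 (1 + x).
Proof.
intros [hx hy].
(* [h1] bounds [ln (1 + y)] by the tangent at [x], and [h2] amounts to [x / (1 + x) < ln (1 + x)].
   Weighting the first by [x] and the second by [y - x] gives the claim. *)
assert (h1 : ln ((1 + y) / (1 + x)) <= (1 + y) / (1 + x) - 1)
  by (apply ln_le_pred, Rdiv_lt_0_compat; lra).
rewrite ln_div in h1 by lra.
assert (h2 : ln (/ (1 + x)) < / (1 + x) - 1).
{ apply ln_lt_pred.
  - apply Rinv_0_lt_compat; lra.
  - intro e. assert (e' : (1 + x) * / (1 + x) = 1) by (field; lra). nra. }
rewrite ln_Rinv in h2 by lra.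
assert (hl := ln2_pos).
unfold log2, Rdiv. rewrite <- !Rmult_assoc.
apply Rmult_lt_compat_r; [apply Rinv_0_lt_compat; lra |].
replace ((1 + y) / (1 + x) - 1) with ((y - x) * / (1 + x)) in h1 by (field; lra).
assert (h3 : x * / (1 + x) < ln (1 + x)).
{ replace (x * / (1 + x)) with (1 - / (1 + x)) by (field; lra). lra. }
assert (h4 : x * (ln (1 + y) - ln (1 + x)) <= x * ((y - x) * / (1 + x)))
  by (apply Rmult_le_compat_l; lra).
assert (h5 : (y - x) * (x * / (1 + x)) < (y - x) * ln (1 + x))
  by (apply Rmult_lt_compat_l; lra).
lra.
Qed.

Lemma efficiency_decr_le (x y : R) : 0 < x <= y ->
  x * log2 (1 + y) <= y * log2 (1 + x).
Proof.
intros [hx [hy | <-]]; [| lra].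
left; apply efficiency_decr; lra.
Qed.

(** Spending a fixed energy over a longer time lowers the power and so sends strictly more bits. In
    particular the duration equation has at most one solution. *)
Lemma duration_le (E T T' : R) : 0 < E -> 0 < T -> 0 < T' ->
  T' * log2 (1 + E / T') <= T * log2 (1 + E / T) -> T' <= T.
Proof.
intros hE hT hT' h. apply Rnot_lt_le. intros hlt.
assert (hr : 0 < E / T' < E / T).
{ split; [apply Rdiv_lt_0_compat; lra |].
  apply Rmult_lt_compat_l, Rinv_lt_contravar; nra. }
generalize (efficiency_decr _ _ hr). intros h1.
apply (Rmult_lt_compat_l (T * T' / E)) in h1.
2: { apply Rdiv_lt_0_compat; nra. }
replace (T * T' / E * (E / T' * log2 (1 + E / T))) with (T * log2 (1 + E / T))
  in h1 by (field; lra).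
replace (T * T' / E * (E / T * log2 (1 + E / T'))) with (T' * log2 (1 + E / T'))
  in h1 by (field; lra).
lra.
Qed.

(** [E / ln 2] is the limit of the left side as [T] grows: the bits that energy [E] buys at
    vanishing power. *)
Lemma bits_lt_limit (E T : R) : 0 < E -> 0 < T ->
  T * log2 (1 + E / T) < E / ln 2.
Proof.
intros hE hT. assert (hl := ln2_pos).
replace (E / ln 2) with (T * (E / T / ln 2)) by (field; lra).
apply Rmult_lt_compat_l; [exact hT |].
apply log2_1p_lt, Rdiv_lt_0_compat; lra.
Qed.

(** A line of slope below 1 through the origin starts below [ln (1 + x)] and ends above it, so the
    intermediate value theorem applies away from 0. *)
Lemma chord_crossing (r : R) : 0 < r < 1 -> exists x, 0 < x /\ ln (1 + x) = r * x.
Proof.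
intros [h0 h1].
(* At [x0], [1 + x0] is the midpoint of 1 and [/ r], so [r * x0 < x0 / (1 + x0) <= ln (1 + x0)]. At
   [y * y - 1], the logarithm is [2 * ln y <= 2 * y - 2], while the line is at [2 * y - r]. *)
set (y := 2 / r). set (x0 := (/ r - 1) / 2).
assert (hr : 1 < / r) by (rewrite <- Rinv_1; apply Rinv_lt_contravar; lra).
assert (hry : r * y = 2) by (unfold y; field; lra).
assert (hrr : r * / r = 1) by (field; lra).
assert (hy : 2 < y) by (unfold y, Rdiv; lra).
destruct (IVT_interv (fun x => r * x - ln (1 + x)) x0 (y * y - 1)) as [x [hx e]].
- intros a ha. apply continuity_pt_filterlim.
  apply (continuous_minus (fun x => r * x) (fun x => ln (1 + x))).
  + apply (continuous_mult (fun _ => r) (fun x => x)).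
    * apply continuous_const.
    * apply continuous_id.
  + apply (continuous_comp (fun x => 1 + x) ln).
    * apply (continuous_plus (fun _ => 1) (fun x => x)).
      -- apply continuous_const.
      -- apply continuous_id.
    * apply continuous_ln.
      unfold x0 in ha. lra.
- unfold x0. unfold y. replace (2 / r) with (2 * / r) by reflexivity. nra.
- assert (hx0 : 0 < x0) by (unfold x0; lra).
  assert (h2 : ln (/ (1 + x0)) <= / (1 + x0) - 1)
    by (apply ln_le_pred, Rinv_0_lt_compat; lra).
  rewrite ln_Rinv in h2 by lra.
  assert (h3 : r * x0 < 1 - / (1 + x0)).
  { replace (1 - / (1 + x0)) with (/ (1 + x0) * x0) by (field; lra).
    apply Rmult_lt_compat_r; [exact hx0 |].
    rewrite <- (Rinv_inv r). apply Rinv_lt_contravar; unfold x0 in *; nra. }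
  lra.
- replace (1 + (y * y - 1)) with (y * y) by ring.
  rewrite ln_mult by lra.
  generalize (ln_le_pred y ltac:(lra)). nra.
- exists x. split; [unfold x0 in hx; lra | lra].
Qed.

(** In terms of the power [x = E / T] the equation reads [ln (1 + x) = (b * ln 2 / E) * x], and the
    slope is below 1. *)
Lemma duration_exists (E b : R) : 0 < b < E / ln 2 ->
  exists T, 0 < T /\ T * log2 (1 + E / T) = b.
Proof.
intros [hb hbE]. assert (hl := ln2_pos).
assert (hE : b * ln 2 < E).
{ apply (Rmult_lt_compat_r (ln 2)) in hbE; [| exact hl].
  replace (E / ln 2 * ln 2) with E in hbE by (field; lra). exact hbE. }
assert (hb2 : 0 < b * ln 2) by nra.
destruct (chord_crossing (b * ln 2 / E)) as [x [hx e]].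
- split; [apply Rdiv_lt_0_compat; lra |].
  apply Rmult_lt_reg_r with E; [lra |].
  replace (b * ln 2 / E * E) with (b * ln 2) by (field; lra). lra.
- exists (E / x). split; [apply Rdiv_lt_0_compat; lra |].
  replace (E / (E / x)) with x by (field; lra).
  unfold log2. rewrite e. field. lra.
Qed.

(** * Least elements and lazy durations *)

Lemma least_finite (S : R -> Prop) (m : R) : is_least S m -> least S = Finite m.
Proof.
intros [hm hmin]. unfold least.
destruct (excluded_middle_informative _) as [h | h].
- destruct (constructive_indefinite_description _ h) as [m' [hm' hmin']]; simpl.
  f_equal. apply Rle_antisym; auto.
- exfalso. apply h. exists m. split; auto.
Qed.

Lemma least_spec (S : R -> Prop) :
  (exists m, least S = Finite m /\ is_least S m) \/ least S = p_infty.
Proof.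
unfold least.
destruct (excluded_middle_informative _) as [h | h]; [left | right; reflexivity].
destruct (constructive_indefinite_description _ h) as [m hm]; simpl.
now exists m.
Qed.

Lemma lazy_duration_spec (E b : R) :
  (exists T, lazy_duration E b = Finite T /\
    0 < b /\ 0 < T /\ T * log2 (1 + E / T) = b) \/
  lazy_duration E b = p_infty.
Proof.
unfold lazy_duration. destruct (Rlt_dec 0 b) as [hb | hb]; [| now right].
destruct (least_spec (fun T => 0 < T /\ T * log2 (1 + E / T) = b))
  as [[m [e [[h1 h2] _]]] | e]; [left | now right].
now exists m.
Qed.

Lemma lazy_duration_finite (E b : R) : 0 < b < E / ln 2 ->
  exists T, lazy_duration E b = Finite T /\ 0 < T /\ T * log2 (1 + E / T) = b.
Proof.
intros hb. assert (hl := ln2_pos).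
assert (hE : 0 < E).
{ replace E with (E / ln 2 * ln 2) by (field; lra).
  apply Rmult_lt_0_compat; lra. }
destruct (duration_exists E b hb) as [T [hT e]].
exists T. split; [| easy].
unfold lazy_duration. destruct (Rlt_dec 0 b) as [_ | n]; [| lra].
apply least_finite. split; [easy |].
intros T' [hT' e']. apply (duration_le E); lra.
Qed.


(** * Integrals: the offline bound and first hitting times *)

Lemma IsStepFun_comp (g f : R -> R) (a b : R) :
  IsStepFun f a b -> IsStepFun (fun x => g (f x)) a b.
Proof.
intros [l [lf [h1 [h2 [h3 [h4 h5]]]]]].
exists l, (List.map g lf).
repeat split; auto.
- now rewrite List.length_map.
- intros i hi x hx.
  rewrite (h5 i hi x hx), RList.RList_P12; [reflexivity | lia].
Qed.

Lemma IsStepFun_ex_RInt (f : R -> R) (a b : R) : IsStepFun f a b -> ex_RInt f a b.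
Proof.
intros h. apply ex_RInt_Reals_1. intros eps.
exists (mkStepFun h), (mkStepFun (StepFun_P4 a b 0)). split.
- intros t _. simpl. unfold fct_cte.
  rewrite Rminus_diag, Rabs_R0. apply Rle_refl.
- rewrite StepFun_P18, Rmult_0_l, Rabs_R0. apply cond_pos.
Qed.

Lemma completion_time_finite (B : R) (P : R -> R) (T : R) :
  completion_time B P = Finite T -> 0 <= T /\ bits_sent P T = B.
Proof.
unfold completion_time. intros h.
destruct (least_spec (fun T => 0 <= T /\ bits_sent P T = B))
  as [[m [e [hm _]]] | e]; rewrite e in h; [| discriminate].
injection h as <-. exact hm.
Qed.

(* Jensen's inequality, in the form of the tangent line of [log2 (1 + x)] at the
   average power [H / T]. *)
Lemma offline_bits_le (sigma : arrivals) (P : R -> R) (T : R) :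
  feasible sigma P -> 0 < T -> 0 <= harvested sigma T ->
  bits_sent P T <= T * log2 (1 + harvested sigma T / T).
Proof.
intros [[hP hstep] hen] hT hH.
set (H := harvested sigma T) in *. set (q := H / T).
destruct (hstep T (Rlt_le _ _ hT)) as [st].
assert (hl := ln2_pos).
assert (hq : 0 <= q) by (apply Rdiv_le_0_compat; lra).
(* [c] is the slope of the tangent at [q]. The energy used is at most [H = T * q], so the term
   [c * (P x - q)] has a nonpositive integral. *)
set (c := / ((1 + q) * ln 2)).
assert (hc : 0 < c) by (apply Rinv_0_lt_compat; nra).
assert (exP : ex_RInt P 0 T) by now apply IsStepFun_ex_RInt.
assert (hP' := RInt_correct _ _ _ exP).
assert (hI : is_RInt (fun x => (log2 (1 + q) - c * q) + c * P x) 0 T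
   ((T - 0) * (log2 (1 + q) - c * q) + c * energy_used P T)).
{ apply (is_RInt_plus (fun _ => log2 (1 + q) - c * q) (fun x => c * P x)).
  - apply @is_RInt_const.
  - now apply @is_RInt_scal. }
apply Rle_trans with ((T - 0) * (log2 (1 + q) - c * q) + c * energy_used P T).
- rewrite <- (is_RInt_unique _ _ _ _ hI). apply RInt_le.
  + lra.
  + apply IsStepFun_ex_RInt. exact (IsStepFun_comp (fun x => log2 (1 + x)) P 0 T st).
  + eexists; exact hI.
  + intros x hx. generalize (log2_1p_tangent q (P x) hq (hP x ltac:(lra))).
    fold c. lra.
- assert (e : T * q = H) by (unfold q; field; lra).
  generalize (hen T (Rlt_le _ _ hT)). fold H. nra.
Qed.

(** [least] is finite only if the minimum is attained. A bounded integrand makes the integral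
    Lipschitz, so the infimum of the level set belongs to it. *)
Lemma least_level_le (f : R -> R) (B x : R) :
  0 <= x -> ex_RInt f 0 x -> RInt f 0 x = B ->
  Rbar_le (least (fun T => 0 <= T /\ RInt f 0 T = B)) x.
Proof.
intros hx hex hB.
set (S := fun T => 0 <= T /\ RInt f 0 T = B).
destruct (ex_RInt_ub f 0 x hex) as [M hM].
rewrite Rmin_left, Rmax_right in hM by exact hx.
assert (hM0 : 0 <= M)
  by (apply Rle_trans with (1 := norm_ge_0 (f 0)), hM; lra).
assert (Lip : forall u v, 0 <= u <= v -> v <= x ->
  Rabs (RInt f 0 v - RInt f 0 u) <= (v - u) * M).
{ intros u v huv hv.
  assert (e0v : ex_RInt f 0 v) by (apply (ex_RInt_Chasles_1 f 0 v x); auto; lra).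
  assert (e0u : ex_RInt f 0 u) by (apply (ex_RInt_Chasles_1 f 0 u v); auto; lra).
  assert (euv : ex_RInt f u v) by (apply (ex_RInt_Chasles_2 f 0 u v); auto; lra).
  rewrite <- (RInt_Chasles f 0 u v e0u euv).
  change (Rabs (RInt f 0 u + RInt f u v - RInt f 0 u) <= (v - u) * M).
  rewrite Rplus_minus_l.
  apply (norm_RInt_le_const f u v (RInt f u v) M).
  - lra.
  - intros t ht. apply hM. lra.
  - now apply @RInt_correct. }
destruct (Glb_Rbar_correct S) as [lb glb].
assert (hlb0 : Rbar_le 0 (Glb_Rbar S)).
{ apply glb. intros y [hy _]. exact hy. }
assert (hubx := lb x (conj hx hB)).
destruct (Glb_Rbar S) as [m | |]; try contradiction.
simpl in hlb0, hubx.
assert (hm : RInt f 0 m = B).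
{ apply Rminus_diag_uniq_sym, Rabs_eq_0, Rle_antisym; [| apply Rabs_pos].
  apply le_epsilon. intros eps heps. rewrite Rplus_0_l.
  (* [M + 1] rather than [M], since the bound [M] may be zero. *)
  set (d := eps / (M + 1)).
  assert (hd : 0 < d) by (apply Rdiv_lt_0_compat; lra).
  assert (hds : exists s, S s /\ m <= s < m + d /\ s <= x).
  { destruct (Rlt_dec x (m + d)) as [hxd | hxd].
    - exists x. repeat split; auto; lra.
    - apply NNPP. intros hn.
      assert (hlb' : Rbar_le (m + d) m); [| simpl in hlb'; lra].
      apply glb. intros s hs. simpl.
      apply Rnot_lt_le. intros hsd. apply hn. exists s.
      generalize (lb s hs). simpl. intros hms. repeat split; try apply hs; lra. }
  destruct hds as [s [[hs0 hsB] [hms hsx]]].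
  rewrite <- hsB. eapply Rle_trans; [apply Lip; lra |].
  replace eps with (d * (M + 1)) by (unfold d; field; lra).
  apply Rmult_le_compat; lra. }
rewrite (least_finite S m); [exact hubx |].
split; [now split |]. intros y hy. exact (lb y hy).
Qed.

(** * Arrival times and harvested energy *)

Lemma in_range_pred (last : option nat) (i : nat) :
  in_range last (S i) = true -> in_range last i = true.
Proof.
unfold in_range. destruct last as [n |]; [| auto].
rewrite !Nat.leb_le. lia.
Qed.

Section Arrivals.

Variable sigma : arrivals.
Local Notation t := (arr_time sigma).
Local Notation e := (arr_energy sigma).

Lemma arrives_0 : arrives sigma 0 = true.
Proof. unfold arrives. now destruct (arr_last sigma). Qed.

Lemma arrives_le (i j : nat) : (i <= j)%nat -> arrives sigma j = true -> arrives sigma i = true.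
Proof.
induction 1 as [| j _ IH]; auto. intros h. apply IH. now apply in_range_pred.
Qed.

Lemma arr_time_le (i j : nat) : (i <= j)%nat -> arrives sigma j = true -> t i <= t j.
Proof.
induction 1 as [| j hij IH]; intros h; [lra |].
apply Rle_trans with (t j); [apply IH; now apply in_range_pred |].
left. now apply arr_time_lt.
Qed.

(** Otherwise every index would arrive by time [s], which contradicts either the finite number of
    arrivals or the divergence of their times. *)
Lemma latest_exists (s : R) : 0 <= s -> exists i, latest_arrival sigma s i.
Proof.
intros hs. apply NNPP. intros hn.
assert (all : forall n, arrives sigma n = true /\ t n <= s).
{ induction n as [| n [IH1 IH2]].
  - split; [apply arrives_0 |]. now rewrite arr_time_0.
  - apply NNPP. intros h. apply hn. exists n. repeat split; auto.
    intros h'. apply Rnot_le_lt. intros h''. now apply h. }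
destruct (arr_last sigma) as [n |] eqn:hlast.
- destruct (all (S n)) as [h _]. unfold arrives in h. rewrite hlast in h.
  apply Nat.leb_le in h. lia.
- generalize (is_lim_seq_le t (fun _ => s) p_infty s (fun n => proj2 (all n))
    (arr_time_lim sigma hlast) (is_lim_seq_const s)). simpl. auto.
Qed.

Lemma after_latest (s : R) (i j : nat) : latest_arrival sigma s i -> (i < j)%nat ->
  arrives sigma j = true -> s < t j.
Proof.
intros [h1 [h2 h3]] hij hj.
apply Rlt_le_trans with (t (S i)).
- apply h3. now apply (arrives_le (S i) j).
- now apply arr_time_le.
Qed.

Lemma current_eq (s : R) (i : nat) : latest_arrival sigma s i -> current sigma s = i.
Proof.
intros h. unfold current.
assert (h' := epsilon_spec (inhabits 0%nat) (latest_arrival sigma s) (ex_intro _ i h)).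
destruct (Nat.lt_total (epsilon (inhabits 0%nat) (latest_arrival sigma s)) i)
  as [hlt | [heq | hlt]]; auto; exfalso.
- generalize (after_latest _ _ _ h' hlt (proj1 h)), (proj1 (proj2 h)). lra.
- generalize (after_latest _ _ _ h hlt (proj1 h')), (proj1 (proj2 h')). lra.
Qed.

(** The terms of the series after index [i] vanish, so its partial sums are constant from [i] on. *)
Lemma harvested_latest (s : R) (i : nat) : latest_arrival sigma s i ->
  harvested sigma s = sum_f_R0 e i.
Proof.
intros h. unfold harvested. apply is_series_unique.
apply (is_lim_seq_ext_loc (fun _ => sum_f_R0 e i) _ (Finite (sum_f_R0 e i)));
  [| apply is_lim_seq_const].
exists i. intros n hn. induction hn as [| n hn IH].
- rewrite sum_n_Reals. apply sum_eq. intros j hj.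
  assert (ha : arrives sigma j = true) by (apply (arrives_le j i); [lia | apply h]).
  rewrite ha. destruct (Rle_dec _ _) as [_ | no]; [reflexivity |].
  exfalso. apply no. apply Rle_trans with (t i); [| apply h].
  apply arr_time_le; [lia | apply h].
- rewrite sum_Sn, <- IH.
  assert (e0 : (if arrives sigma (S n) then
     if Rle_dec (arr_time sigma (S n)) s then arr_energy sigma (S n) else 0 else 0) = 0).
  { destruct (arrives sigma (S n)) eqn:ha; [| reflexivity].
    destruct (Rle_dec _ _) as [hle |]; [| reflexivity].
    assert (hlt : (i < S n)%nat) by lia.
    generalize (after_latest _ _ _ h hlt ha). lra. }
  rewrite e0. unfold plus; simpl. ring.
Qed.

(** * Steps of the lazy algorithm and what they preserve *)

Variable B : R.

(** An infinite duration means either a finished transmission or an unsolvable plan. Both give power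
    zero, so nothing is spent or sent. *)
Lemma lazy_state_idle (i : nat) (E b : R) :
  lazy_state sigma B i = (E, b) -> lazy_duration E b = p_infty ->
  lazy_state sigma B (S i) = (E + e (S i), b).
Proof.
intros hs hd. simpl. rewrite hs. unfold lazy_rate. rewrite hd. simpl.
rewrite log2_0. f_equal; ring.
Qed.

Lemma lazy_state_done (i : nat) (E b T : R) :
  lazy_state sigma B i = (E, b) -> lazy_duration E b = Finite T ->
  T <= t (S i) - t i ->
  lazy_state sigma B (S i) = (e (S i), 0).
Proof.
intros hs hd hT. simpl. rewrite hs. unfold lazy_rate. rewrite hd. simpl.
rewrite Rmin_right by exact hT.
destruct (lazy_duration_spec E b) as [[T' [hd' [hb [hT' heq]]]] | hd'];
  rewrite hd in hd'; [| discriminate].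
injection hd' as <-. rewrite heq. f_equal; [| ring]. field. lra.
Qed.

Lemma lazy_state_run (i : nat) (E b T : R) :
  lazy_state sigma B i = (E, b) -> lazy_duration E b = Finite T ->
  t (S i) - t i < T ->
  let d := t (S i) - t i in
  lazy_state sigma B (S i) =
    (E / T * (T - d) + e (S i), (T - d) * log2 (1 + E / T)).
Proof.
intros hs hd hT d. simpl. rewrite hs. unfold lazy_rate. rewrite hd. simpl.
rewrite Rmin_left by lra.
destruct (lazy_duration_spec E b) as [[T' [hd' [hb [hT' heq]]]] | hd'];
  rewrite hd in hd'; [| discriminate].
injection hd' as <-. unfold d. f_equal.
- field. lra.
- rewrite <- heq at 1. ring.
Qed.

(* Last clause: the energy [H - E] already spent bought at least as many bits per
   unit as the current power does. *)
Definition lazy_invariant (i : nat) (E b : R) : Prop :=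
  let H := sum_f_R0 e i in
  0 < E /\ 0 <= b /\
  (b = 0 \/
   E <= H /\ (b < E / ln 2 \/ E = H /\ b = B) /\
   forall T, lazy_duration E b = Finite T ->
     (H - E) * log2 (1 + E / T) <= (B - b) * (E / T)).

(** Even without [e'] the old plan would finish after a further [T - d] at power [E / T]. The extra
    energy can only shorten the plan, and more energy in less time means a higher power. *)
Lemma lazy_run_faster (E T d e' : R) : 0 < E -> 0 < d < T -> 0 < e' ->
  let E' := E / T * (T - d) + e' in
  let b' := (T - d) * log2 (1 + E / T) in
  0 < b' < E' / ln 2 /\
  exists T', lazy_duration E' b' = Finite T' /\ 0 < T' <= T - d /\ E / T <= E' / T'.
Proof.
intros hE hd he E' b'. assert (hl := ln2_pos).
assert (hp : 0 < E / T) by (apply Rdiv_lt_0_compat; lra).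
assert (hlp := log2_1p_pos _ hp).
set (p := E / T) in *.
assert (hE' : 0 < E') by (unfold E'; nra).
assert (hpE : p * (T - d) < E') by (unfold E'; lra).
assert (hb' : 0 < b' < E' / ln 2).
{ split; [unfold b'; nra |].
  apply Rlt_le_trans with (p * (T - d) / ln 2).
  - unfold b'. generalize (log2_1p_lt p hp). unfold Rdiv. nra.
  - apply Rmult_le_compat_r; [left; now apply Rinv_0_lt_compat | lra]. }
split; [exact hb' |].
destruct (lazy_duration_finite E' b' hb') as [T' [hd' [hT' heq]]].
assert (hpE' : p < E' / (T - d)).
{ apply Rmult_lt_reg_r with (T - d); [lra |].
  replace (E' / (T - d) * (T - d)) with E' by (field; lra). lra. }
(* Spreading [E'] over [T - d] would send at least [b'] bits. *)
assert (hTT : T' <= T - d).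
{ apply (duration_le E'); try lra. rewrite heq. unfold b'.
  apply Rmult_le_compat_l; [lra |].
  apply Rmult_le_compat_r; [left; now apply Rinv_0_lt_compat |].
  apply ln_le; lra. }
exists T'. repeat split; auto.
apply Rle_trans with (E' / (T - d)); [lra |].
apply Rmult_le_compat_l; [lra |]. apply Rinv_le_contravar; lra.
Qed.

Hypothesis hB : 0 < B.

Lemma lazy_invariant_holds (i : nat) : arrives sigma i = true ->
  lazy_invariant i (fst (lazy_state sigma B i)) (snd (lazy_state sigma B i)).
Proof.
assert (hl := ln2_pos).
induction i as [| i IH]; intros ha.
- simpl. assert (he := arr_energy_pos sigma 0 ha). unfold lazy_invariant; simpl.
  split; [exact he |]. split; [lra |]. right. split; [lra |].
  split; [now right |]. intros T _. lra.
- assert (he : 0 < e (S i)) by now apply arr_energy_pos.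
  assert (hgap : t i < t (S i)) by now apply arr_time_lt.
  specialize (IH (in_range_pred _ _ ha)).
  destruct (lazy_state sigma B i) as [E b] eqn:hs.
  unfold fst, snd in IH. destruct IH as [hE [hb hor]].
  destruct (lazy_duration_spec E b) as [[T [hd [hb0 [hT heq]]]] | hd].
  + destruct (Rle_lt_dec T (t (S i) - t i)) as [hTd | hTd].
    * rewrite (lazy_state_done i E b T hs hd hTd). simpl.
      split; [exact he |]. split; [lra | now left].
    * rewrite (lazy_state_run i E b T hs hd hTd). unfold fst, snd.
      set (d := t (S i) - t i) in *.
      assert (hd0 : 0 < d) by (unfold d; lra).
      destruct (lazy_run_faster E T d (e (S i)) hE (conj hd0 hTd) he)
        as [hb' [T' [hd' [hT' hp']]]].
      destruct hor as [hb1 | [hEH [_ heff]]]; [lra |].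
      specialize (heff T hd).
      split; [| split; [lra | right; split; [| split; [now left |]]]].
      -- assert (0 < E / T) by (apply Rdiv_lt_0_compat; lra). nra.
      -- assert (hp : E = E / T * T) by (field; lra).
         assert (0 < E / T) by (apply Rdiv_lt_0_compat; lra).
         rewrite tech5. nra.
      -- intros T'' hd''. rewrite hd' in hd''. injection hd'' as <-.
         rewrite tech5.
         assert (hp0 : 0 < E / T) by (apply Rdiv_lt_0_compat; lra).
         assert (hp : E = E / T * T) by (field; lra).
         set (p := E / T) in *.
         set (p' := (p * (T - d) + e (S i)) / T') in *.
         assert (hmono := efficiency_decr_le p p' (conj hp0 hp')).
         replace (sum_f_R0 e i + e (S i) - (p * (T - d) + e (S i)))
           with (sum_f_R0 e i - E + p * d) by (rewrite hp; ring).
         replace (B - (T - d) * log2 (1 + p)) with (B - b + d * log2 (1 + p))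
           by (rewrite <- heq; ring).
         (* The energy spent so far is the old [H - E] plus [p * d] from this step. All of it was at
            least as efficient as power [p], which is at least as efficient as the new power
            [p']. *)
         apply Rmult_le_reg_l with p; [exact hp0 |].
         apply Rle_trans with
           ((sum_f_R0 e i - E + p * d) * (p' * log2 (1 + p))).
         ++ replace (p * ((sum_f_R0 e i - E + p * d) * log2 (1 + p')))
              with ((sum_f_R0 e i - E + p * d) * (p * log2 (1 + p'))) by ring.
            apply Rmult_le_compat_l; [nra | exact hmono].
         ++ assert (h : p' * ((sum_f_R0 e i - E) * log2 (1 + p)) <= p' * ((B - b) * p))
              by (apply Rmult_le_compat_l; [lra | exact heff]).
            lra.
  + rewrite (lazy_state_idle i E b hs hd). unfold fst, snd.
    split; [lra |]. split; [exact hb |].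
    destruct hor as [hb1 | [hEH [hst _]]]; [now left |].
    destruct (Req_dec b 0) as [hb0 | hb0]; [now left | right].
    (* Idling with bits left is possible only before anything was spent, since [b < E / ln 2] would
       give a finite plan. *)
    destruct hst as [hbE | [hEH' hbB]].
    * destruct (lazy_duration_finite E b) as [T [hd' _]]; [lra |].
      rewrite hd in hd'. discriminate.
    * rewrite tech5. split; [lra |]. split; [right; split; [lra | exact hbB] |].
      intros T _. rewrite hEH', hbB. lra.
Qed.

(** The case [b = 0] is separate because [lazy_duration] is infinite once transmission is
    complete. *)
Definition done_by (X : R) (i : nat) : Prop :=
  let (E, b) := lazy_state sigma B i in
  b = 0 \/ exists T, lazy_duration E b = Finite T /\ t i + T <= X.

(** An interrupted plan is replaced by one with [T' <= T - d], so the projected completion time does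
    not move later. *)
Lemma done_by_next (X : R) (i : nat) : arrives sigma (S i) = true ->
  done_by X i -> done_by X (S i).
Proof.
intros ha. unfold done_by at 1.
assert (hinv := lazy_invariant_holds i (in_range_pred _ _ ha)).
assert (he : 0 < e (S i)) by now apply arr_energy_pos.
assert (hgap : t i < t (S i)) by now apply arr_time_lt.
destruct (lazy_state sigma B i) as [E b] eqn:hs.
unfold fst, snd in hinv. destruct hinv as [hE [hb _]].
unfold done_by. intros [hb0 | [T [hd hX]]].
- rewrite (lazy_state_idle i E b hs); [now left |].
  unfold lazy_duration. destruct (Rlt_dec 0 b); [lra | reflexivity].
- destruct (Rle_lt_dec T (t (S i) - t i)) as [hTd | hTd].
  + rewrite (lazy_state_done i E b T hs hd hTd). now left.
  + rewrite (lazy_state_run i E b T hs hd hTd). right.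
    assert (hd0 : 0 < t (S i) - t i) by lra.
    destruct (lazy_run_faster E T _ (e (S i)) hE (conj hd0 hTd) he)
      as [_ [T' [hd' [hT' _]]]].
    exists T'. split; [exact hd' | lra].
Qed.

Lemma done_by_le (X : R) (i j : nat) : (i <= j)%nat -> arrives sigma j = true ->
  done_by X i -> done_by X j.
Proof.
induction 1 as [| j hij IH]; auto. intros ha h.
apply done_by_next; [exact ha |]. apply IH; [now apply in_range_pred | exact h].
Qed.

(** * Bits sent by the lazy profile *)

Local Notation f := (fun s : R => log2 (1 + lazy_profile sigma B s)).

Lemma lazy_piece (i : nat) (E b u : R) :
  lazy_state sigma B i = (E, b) -> arrives sigma i = true -> t i <= u ->
  (arrives sigma (S i) = true -> u <= t (S i)) ->
  is_RInt f (t i) u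
    (real (Rbar_min (u - t i) (lazy_duration E b)) * log2 (1 + lazy_rate E b)).
Proof.
intros hs ha hu hnext.
assert (hf : forall s, t i < s < u -> f s =
  if Rbar_lt_dec (s - t i) (lazy_duration E b) then log2 (1 + lazy_rate E b) else 0).
{ intros s hsu. unfold lazy_profile. rewrite (current_eq s i).
  - rewrite hs. destruct (Rbar_lt_dec _ _); auto using log2_0.
  - split; [exact ha |]. split; [lra |].
    intros h. specialize (hnext h). lra. }
assert (hc : forall a v c, is_RInt (fun _ => c) a v ((v - a) * c))
  by (intros; apply @is_RInt_const).
destruct (lazy_duration_spec E b) as [[T [hd [hb0 [hT heq]]]] | hd].
- rewrite hd in *. simpl. destruct (Rle_lt_dec (u - t i) T) as [h | h].
  + rewrite Rmin_left by exact h.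
    apply (is_RInt_ext (fun _ => log2 (1 + lazy_rate E b))); [| apply hc].
    intros s hsu. rewrite Rmin_left, Rmax_right in hsu by lra.
    rewrite hf by lra. destruct (Rbar_lt_dec _ _) as [_ | n]; [reflexivity |].
    simpl in n. lra.
  + rewrite Rmin_right by lra.
    replace (T * log2 (1 + lazy_rate E b)) with
      (plus ((t i + T - t i) * log2 (1 + lazy_rate E b)) ((u - (t i + T)) * 0))
      by (unfold plus; simpl; ring).
    (* The plan ends before [u]: the rate is constant up to [t i + T] and the profile is silent
       afterwards. *)
    apply (@is_RInt_Chasles R_NormedModule) with (t i + T).
    * apply (is_RInt_ext (fun _ => log2 (1 + lazy_rate E b))); [| apply hc].
      intros s hsu. rewrite Rmin_left, Rmax_right in hsu by lra.
      rewrite hf by lra. destruct (Rbar_lt_dec _ _) as [_ | n]; [reflexivity |].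
      simpl in n. lra.
    * apply (is_RInt_ext (fun _ => 0)); [| apply hc].
      intros s hsu. rewrite Rmin_left, Rmax_right in hsu by lra.
      rewrite hf by lra. destruct (Rbar_lt_dec _ _) as [n | _]; [| reflexivity].
      simpl in n. lra.
- rewrite hd in *. simpl.
  apply (is_RInt_ext (fun _ => log2 (1 + lazy_rate E b))); [| apply hc].
  intros s hsu. rewrite Rmin_left, Rmax_right in hsu by lra.
  rewrite hf by lra. destruct (Rbar_lt_dec _ _) as [_ | n]; [reflexivity |].
  simpl in n. tauto.
Qed.

(** The pieces telescope: each step of [lazy_state] subtracts from the remaining bits exactly the
    integral over one interval between arrivals. *)
Lemma lazy_sent (i : nat) : arrives sigma i = true ->
  is_RInt f 0 (t i) (B - snd (lazy_state sigma B i)).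
Proof.
induction i as [| i IH]; intros ha.
- rewrite arr_time_0. simpl. rewrite Rminus_diag. apply @is_RInt_point.
- specialize (IH (in_range_pred _ _ ha)).
  assert (hgap : t i < t (S i)) by now apply arr_time_lt.
  destruct (lazy_state sigma B i) as [E b] eqn:hs.
  assert (hp := lazy_piece i E b (t (S i)) hs (in_range_pred _ _ ha)
    (Rlt_le _ _ hgap) (fun _ => Rle_refl _)).
  generalize (is_RInt_Chasles _ _ _ _ _ _ IH hp).
  cbn [lazy_state]. rewrite hs. unfold plus; simpl.
  match goal with |- is_RInt _ _ _ ?x -> is_RInt _ _ _ ?y => replace y with x by ring end.
  auto.
Qed.

Lemma lazy_time_le (X : R) (i : nat) : arrives sigma i = true -> t i <= X ->
  done_by X i -> Rbar_le (lazy_time sigma B) X.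
Proof.
intros ha hi hdone.
assert (hX : 0 <= X).
{ apply Rle_trans with (2 := hi). rewrite <- (arr_time_0 sigma).
  apply arr_time_le; [lia | exact ha]. }
(* No arrival after the [j]-th comes by time [X], so the plan made at [t j] runs to its end
   uninterrupted. *)
destruct (latest_exists X hX) as [j hj].
assert (hij : (i <= j)%nat).
{ apply Nat.nlt_ge. intros hlt. generalize (after_latest _ _ _ hj hlt ha). lra. }
assert (haj := proj1 hj).
assert (hj' : done_by X j) by now apply (done_by_le X i).
assert (hsent := lazy_sent j haj).
enough (h : exists x, 0 <= x <= X /\ is_RInt f 0 x B).
{ destruct h as [x [hx hI]].
  apply Rbar_le_trans with x; [| exact (proj2 hx)].
  apply least_level_le; [easy | now exists B |].
  now apply is_RInt_unique. }
assert (htj : 0 <= t j).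
{ rewrite <- (arr_time_0 sigma). apply arr_time_le; [lia | exact haj]. }
unfold done_by in hj'. destruct (lazy_state sigma B j) as [E b] eqn:hs.
simpl in hsent. destruct hj' as [hb | [T [hd hTX]]].
- exists (t j). split; [split; [exact htj | apply hj] |].
  rewrite hb, Rminus_0_r in hsent. exact hsent.
- destruct (lazy_duration_spec E b) as [[T' [hd' [hb0 [hT heq]]]] | hd'];
    rewrite hd in hd'; [| discriminate].
  injection hd' as <-.
  exists (t j + T). split; [lra |].
  assert (hp : is_RInt f (t j) (t j + T)
    (real (Rbar_min (t j + T - t j) (lazy_duration E b)) * log2 (1 + lazy_rate E b))).
  { apply lazy_piece; auto; [lra |].
    intros h. apply Rle_trans with (1 := hTX). left. now apply hj. }
  unfold lazy_rate in hp. rewrite hd in hp. simpl in hp.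
  replace (t j + T - t j) with T in hp by ring.
  rewrite Rmin_left, heq in hp by lra.
  generalize (is_RInt_Chasles _ _ _ _ _ _ hsent hp). unfold plus; simpl.
  now replace (B - b + b) with B by ring.
Qed.

(** * Comparison with a feasible profile and passage to the infimum *)

Lemma lazy_time_le_feasible (P : R -> R) (T : R) :
  feasible sigma P -> completion_time B P = Finite T ->
  Rbar_le (lazy_time sigma B) (2 * T).
Proof.
intros hP hc. assert (hl := ln2_pos).
destruct (completion_time_finite _ _ _ hc) as [hT0 hbits].
assert (hT : 0 < T).
{ destruct hT0 as [h | <-]; [exact h |]. exfalso. unfold bits_sent in hbits.
  rewrite RInt_point in hbits. unfold zero in hbits; simpl in hbits. lra. }
destruct (latest_exists T hT0) as [k hk].
assert (hH := harvested_latest T k hk).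
destruct (lazy_invariant_holds k (proj1 hk)) as [hE [hb hor]].
assert (hk' := proj1 (proj2 hk)).
apply (lazy_time_le _ k); [apply hk | lra |].
unfold done_by. destruct (lazy_state sigma B k) as [E b] eqn:hs.
unfold fst, snd in hE, hb, hor.
destruct hor as [hb0 | [hEH [hst heff]]]; [now left |].
set (H := sum_f_R0 e k) in *.
destruct (Req_dec b 0) as [hb0 | hb0]; [now left | right].
assert (hoff : B <= T * log2 (1 + H / T)).
{ rewrite <- hbits, <- hH. apply offline_bits_le; auto. rewrite hH. lra. }
(* If nothing has been spent yet, then [b = B] and [E = H], and the offline bound stays strictly
   below [H / ln 2]. *)
assert (hbE : b < E / ln 2).
{ destruct hst as [h | [-> ->]]; [exact h |].
  generalize (bits_lt_limit H T ltac:(lra) hT). lra. }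
destruct (lazy_duration_finite E b) as [Tk [hd [hTk heq]]]; [lra |].
exists Tk. split; [exact hd |]. specialize (heff Tk hd).
(* The last plan starts at [t k <= T]; this is where the factor 2 comes from. *)
enough (Tk <= T) by lra.
assert (hp : 0 < E / Tk) by (apply Rdiv_lt_0_compat; lra).
assert (hpE : E = E / Tk * Tk) by (field; lra).
assert (hq : 0 < H / T) by (apply Rdiv_lt_0_compat; lra).
assert (hqH : H = H / T * T) by (field; lra).
set (p := E / Tk) in *. set (q := H / T) in *.
assert (hcmp : q * log2 (1 + p) <= p * log2 (1 + q)).
{ apply Rmult_le_reg_l with T; [exact hT |].
  apply Rle_trans with (H * log2 (1 + p)); [rewrite hqH; lra |].
  apply Rle_trans with (B * p).
  (* The spent part [H - E] is handled by the invariant, and the remaining [E] buys exactly [b] bits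
     at power [p]. *)
  - replace (H * log2 (1 + p)) with
      ((H - E) * log2 (1 + p) + p * (Tk * log2 (1 + p)))
      by (rewrite hpE; ring).
    rewrite heq. lra.
  - apply Rle_trans with ((T * log2 (1 + q)) * p); [| lra].
    apply Rmult_le_compat_r; lra. }
assert (hqp : q <= p).
{ apply Rnot_lt_le. intros h. generalize (efficiency_decr p q (conj hp h)). lra. }
(* The chain is [q * Tk <= p * Tk = E <= H = q * T]. *)
apply Rmult_le_reg_l with q; [exact hq |].
apply Rle_trans with (p * Tk); [nra |].
rewrite <- hpE. lra.
Qed.

End Arrivals.

Theorem theorem2 (B : R) (hB : 0 < B) (sigma : arrivals)
    (hT : Rbar_lt (offline_time sigma B) p_infty)
    (hE : Rbar_le (Finite B)
            (Lim (fun T => T * log2 (1 + arr_energy sigma 0 / T)) p_infty)) :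
  Rbar_le (lazy_time sigma B) (Rbar_mult (Finite 2) (offline_time sigma B)).
Proof.
unfold offline_time in *.
set (S := fun T => exists P, feasible sigma P /\ completion_time B P = Finite T) in *.
destruct (Glb_Rbar_correct S) as [_ glb].
assert (hlazy : forall T, S T -> Rbar_le (lazy_time sigma B) (2 * T)).
{ intros T [P [hP hc]]. now apply (lazy_time_le_feasible sigma B hB P). }
assert (h0 : Rbar_le 0 (Glb_Rbar S)).
{ apply glb. intros T [P [_ hc]]. now apply completion_time_finite in hc. }
assert (hne : exists T, S T).
{ apply NNPP. intros hn. assert (h : Rbar_le p_infty (Glb_Rbar S)).
  - apply glb. intros T h. exfalso. apply hn. now exists T.
  - now apply Rbar_le_not_lt in h. }
destruct (lazy_time sigma B) as [v | |] eqn:hv.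
(* Since [v <= 2 * T] for every [T] in [S], [v / 2] is a lower bound of [S], hence at most its
   infimum. *)
- assert (h : Rbar_le (v / 2) (Glb_Rbar S)).
  { apply glb. intros T hS. generalize (hlazy T hS). simpl. lra. }
  destruct (Glb_Rbar S) as [m | |]; try contradiction.
  simpl in *. lra.
- destruct hne as [T hS]. now destruct (hlazy T hS).
- exact I.
Qed.
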